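(* Let $(W,S)$ be a Coxeter system with $S=D$ finite and $W$ infinite. Suppose $W(t)=R(t)/S(t)$ where $R(t)=\prod_{i=1}^m[n_i]$ for some integers $n_i\ge 2$ and $S(t)$ is a polynomial; put $N=\sum_{i=1}^m(n_i-1)$ and let $b_j$ be the coefficient of $t^j$ in $S(t)$. Then $$b_{N-1}-m\,b_N=\sum_{X\subsetneq D,\ |W_X|=\infty}(-1)^{|X|}|X|+(-1)^{|D|}|D|.$$
   Context: $[n]=1+t+\dots+t^{n-1}$. For $X\subseteq S$, $W_X$ is the special subgroup generated by $X$; $W(t)=\sum_{g\in W}t^{l(g)}$ is the Poincaré series with respect to word length in $S$ (a rational function). *)

(* Defs.v *)
From HB Require Import structures.
From mathcomp Require Import all_boot all_order all_algebra.
From Stdlib Require Import Relations ClassicalEpsilon.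
Set Implicit Arguments. Unset Strict Implicit. Unset Printing Implicit Defensive.
Import Order.TTheory GRing.Theory Num.Theory.

(* Coxeter matrix on the finite generating set D: M s t = 0 encodes m_st = oo. *)
Definition is_coxeter_matrix (D : finType) (M : D -> D -> nat) : Prop :=
  (forall s, M s s = 1%N) /\ (forall s t, M s t = M t s) /\
  (forall s t, s != t -> M s t != 1%N).

Fixpoint alt (D : Type) (s t : D) (n : nat) : seq D :=
  if n is n'.+1 then s :: alt t s n' else [::].

Inductive cstep (D : finType) (M : D -> D -> nat) : seq D -> seq D -> Prop :=
| cs_del p q s : cstep M (p ++ [:: s; s] ++ q) (p ++ q)
| cs_ins p q s : cstep M (p ++ q) (p ++ [:: s; s] ++ q)
| cs_braid p q s t : s != t -> M s t != 0%N ->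
    cstep M (p ++ alt s t (M s t) ++ q) (p ++ alt t s (M s t) ++ q).

(* two words represent the same element of W *)
Definition coxeq (D : finType) (M : D -> D -> nat) : relation (seq D) :=
  clos_refl_sym_trans _ (cstep M).

Definition reduced (D : finType) (M : D -> D -> nat) (w : seq D) : Prop :=
  forall v, coxeq M w v -> (size w <= size v)%N.

(* W has exactly c elements of length k (c = coefficient of t^k in W(t)) *)
Definition num_of_length (D : finType) (M : D -> D -> nat) (k c : nat) : Prop :=
  exists ws : seq (seq D),
    size ws = c /\
    (forall w, w \in ws -> size w = k /\ reduced M w) /\
    (forall i j, (i < c)%N -> (j < c)%N -> i <> j ->
       ~ coxeq M (nth [::] ws i) (nth [::] ws j)) /\
    (forall w, size w = k -> reduced M w -> exists2 v, v \in ws & coxeq M w v).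

Definition special_infinite (D : finType) (M : D -> D -> nat) (X : {set D}) : Prop :=
  forall n : nat, exists ws : seq (seq D),
    size ws = n /\ (forall w, w \in ws -> {subset w <= X}) /\
    (forall i j, (i < n)%N -> (j < n)%N -> i <> j ->
       ~ coxeq M (nth [::] ws i) (nth [::] ws j)).

Definition pbool (P : Prop) : bool :=
  if excluded_middle_informative P then true else false.

Definition qint (n : nat) : {poly rat} := \sum_(i < n) 'X^i.

(* Main.v *)
(* Write A_Y(t) for the length series of the elements whose left descent set contains Y.
   Only finite W_Y contribute, and inclusion-exclusion gives sum_Y (-1)^|Y| A_Y = 1.  Every
   coset W_Y w has a unique longest element x, and those are exactly the elements counted by
   A_Y; as len (u x) = len x - len u for u in W_Y, we get A_Y(t) Q_Y(t) = t^(L_Y) W(t), where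
   L_Y is the maximal length in W_Y and Q_Y(t) = sum_(u in W_Y) t^(L_Y - len u).  Clearing
   denominators,
     S prod_Y Q_Y = R sum_Y (-1)^|Y| t^(L_Y) prod_(Z <> Y) Q_Z,
   and since Q_Y = t^(L_Y) + |Y| t^(L_Y - 1) + ..., comparing the two leading coefficients
   expresses b_(N-1) - m b_N as - sum_(W_Y finite) (-1)^|Y| |Y|; the sum over all Y vanishes.
   The exchange property comes from the parity with which a reflection occurs in a word; that
   distinct generators differ in W is read off the numbers game (the dual of the geometric
   representation) over the algebraic numbers. *)
Require Import Defs.
From HB Require Import structures.
From mathcomp Require Import all_boot all_order all_algebra all_field.
From mathcomp Require Import zify ring.
From Stdlib Require Import Relations ClassicalEpsilon.
Set Implicit Arguments.
Unset Strict Implicit.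
Unset Printing Implicit Defensive.
Import Order.TTheory GRing.Theory Num.Theory.
Local Open Scope ring_scope.

Lemma pboolP (P : Prop) : reflect P (pbool P).
Proof. by rewrite /pbool; case: excluded_middle_informative => H; constructor. Qed.

(** * Alternating words *)

Lemma size_alt (T : Type) (s t : T) n : size (alt s t n) = n.
Proof. by elim: n s t => //= n IH s t; rewrite IH. Qed.

Lemma alt_cat (T : Type) (s t : T) a b :
  alt s t (a + b) = alt s t a ++ (if odd a then alt t s b else alt s t b).
Proof.
elim: a s t => //= a IH s t; rewrite IH.
by case: (odd a).
Qed.

Lemma rev_alt (T : Type) (s t : T) n :
  rev (alt s t n) = if odd n then alt s t n else alt t s n.
Proof.
elim: n s t => [|n IH] s t //.
rewrite [alt s t n.+1]/= rev_cons IH -cats1 /=.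
have E (x y : T) : alt x y n ++ [:: (if odd n then y else x)] = alt x y n.+1.
  by rewrite -addn1 alt_cat; case: (odd n).
case: (odd n) (E s t) (E t s) => /= E1 E2.
  by rewrite E2.
by rewrite E1.
Qed.

(** * The numbers game and the separation of generators in W *)

Section NumbersGame.
Variables (D : finType) (F : fieldType) (c : D -> D -> F).
Implicit Types (s t r : D) (f : {ffun D -> F}).

(** The simple reflection [s] on the dual of the geometric representation. The weight [c s r] will
    be z + 1/z with z a primitive 2m-th root of unity, in the place of 2 cos(pi/m). *)
Definition fire f s : {ffun D -> F} :=
  [ffun r => if r == s then - f s else f r + c s r * f s].

Definition play (w : seq D) f := foldl fire f w.

Lemma play_cat u v f : play (u ++ v) f = play v (play u f).
Proof. exact: foldl_cat. Qed.

Lemma fireK s f : fire (fire f s) s = f.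
Proof.
apply/ffunP => r; rewrite !ffunE eqxx.
by case: eqP => [->|_]; [rewrite opprK | rewrite mulrN addrK].
Qed.

(* Successive values at the vertices fired alternately along an edge of weight [a]. *)
Fixpoint fired (a x0 x1 : F) n :=
  if n is n'.+1 then fired a x1 (a * x1 - x0) n' else x0.

(** Each firing produces the next term of x_(n+1) = a x_n - x_(n-1). The start x_0 = - f t, x_1 = f
    s treats [t] as the vertex fired just before, so the last vertex fired holds - x_n and the other
    one x_(n+1). *)
Lemma play_alt s t f n : s != t -> c s t = c t s ->
  play (alt s t n) f (if odd n then s else t) = - fired (c s t) (- f t) (f s) n /\
  play (alt s t n) f (if odd n then t else s) = fired (c s t) (- f t) (f s) n.+1.
Proof.
elim: n s t f => [|n IH] s t f st cst; first by rewrite /= opprK.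
have ts : t != s by rewrite eq_sym.
have [] := IH t s (fire f s) ts (esym cst).
rewrite !ffunE eqxx (negPf ts) opprK -cst.
have -> : f t + c s t * f s = c s t * f s - - f t by rewrite opprK addrC.
by move=> E1 E2; split; [move: E1 | move: E2] => /=; case: (odd n).
Qed.

(** [z] and [y] are the roots of the characteristic polynomial X^2 - (z + y) X + 1 of the
    recurrence. *)
Lemma fired_closed (z y al be : F) n : z * y = 1 ->
  fired (z + y) (al + be) (al * z + be * y) n = al * z ^+ n + be * y ^+ n.
Proof.
move=> zy; elim: n al be => [|n IH] al be /=; first by rewrite !expr0 !mulr1.
have -> : (z + y) * (al * z + be * y) - (al + be) = (al * z) * z + (be * y) * y.
  have -> : (z + y) * (al * z + be * y) = al * z * z + be * y * y + (al + be) * (z * y).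
    by ring.
  by rewrite zy mulr1 addrK.
by rewrite IH !exprS !mulrA.
Qed.

(** As [z != y], any initial values come from a combination of z^n and y^n, and both m-th powers are
    -1. *)
Lemma fired_half_turn (z y x0 x1 : F) m : z * y = 1 -> z != y -> z ^+ m = - 1 ->
  fired (z + y) x0 x1 m = - x0 /\ fired (z + y) x0 x1 m.+1 = - x1.
Proof.
move=> zy nzy zm; have ym : y ^+ m = - 1.
  by have := exprMn m z y; rewrite zy expr1n zm mulN1r => ->; rewrite opprK.
have d0 : z - y != 0 by rewrite subr_eq0.
pose al := (x1 - x0 * y) / (z - y); pose be := (x0 * z - x1) / (z - y).
have Ex0 : x0 = al + be by rewrite /al /be; field.
have Ex1 : x1 = al * z + be * y by rewrite /al /be; field.
rewrite Ex0 Ex1 !fired_closed // !exprS zm ym.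
by split; ring.
Qed.

(** At [s] and [t] both words yield - f s and - f t, exchanged when [m] is odd; the other
    coordinates follow from a quantity that both generators preserve. *)
Lemma play_braid s t m (z y : F) f : s != t -> c s t = c t s -> c s t = z + y ->
  z * y = 1 -> z != y -> z ^+ m = - 1 ->
  play (alt s t m) f = play (alt t s m) f.
Proof.
move=> st cst cE zy nzy zm; have ts : t != s by rewrite eq_sym.
have [A1 A2] := play_alt f m st cst.
have [B1 B2] := play_alt f m ts (esym cst).
rewrite -cst in B1 B2; rewrite cE in A1 A2 B1 B2.
have [E1 E2] := fired_half_turn (- f t) (f s) zy nzy zm.
have [E3 E4] := fired_half_turn (- f s) (f t) zy nzy zm.
rewrite E1 opprK in A1; rewrite E2 in A2; rewrite E3 opprK in B1; rewrite E4 in B2.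
have Es : play (alt s t m) f s = play (alt t s m) f s.
  by case: (odd m) A1 A2 B1 B2 => A1 A2 B1 B2; rewrite ?A1 ?A2 ?B1 ?B2.
have Et : play (alt s t m) f t = play (alt t s m) f t.
  by case: (odd m) A1 A2 B1 B2 => A1 A2 B1 B2; rewrite ?A1 ?A2 ?B1 ?B2.
apply/ffunP => r.
have [->//|rs] := eqVneq r s; have [->//|rt] := eqVneq r t.
(* Determinant of the linear system that [al] and [be] solve to make [I] below invariant; it equals
   -(z - y)^2 because z y = 1. *)
have d0 : 4%:R - (z + y) ^+ 2 != 0.
  have -> : 4%:R - (z + y) ^+ 2 = - (z - y) ^+ 2 + 4%:R * (1 - z * y) by ring.
  by rewrite zy subrr mulr0 addr0 oppr_eq0 expf_eq0 subr_eq0.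
pose al := (2%:R * c s r + (z + y) * c t r) / (4%:R - (z + y) ^+ 2).
pose be := (2%:R * c t r + (z + y) * c s r) / (4%:R - (z + y) ^+ 2).
(* The coordinate at [r], corrected by the projection to the plane of [s] and [t],
   is fixed by both generators. *)
pose I (g : {ffun D -> F}) := g r + al * g s + be * g t.
have Is g : I (fire g s) = I g.
  rewrite /I !ffunE eqxx (negPf rs) (negPf ts) cE /al /be; field.
  by rewrite -?expr2.
have It g : I (fire g t) = I g.
  rewrite /I !ffunE eqxx (negPf rt) (negPf st) -cst cE /al /be; field.
  by rewrite -?expr2.
have Ialt n : forall g, I (play (alt s t n) g) = I g /\ I (play (alt t s n) g) = I g.
  elim: n => [|n IH] g //=; split.
    by have [_ ->] := IH (fire g s).
  by have [-> _] := IH (fire g t).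
have [] := Ialt m f; rewrite /I Es Et => <- /addIr/addIr; exact: esym.
Qed.

End NumbersGame.

(** Take [z] a primitive 2m-th root of unity and [y] its inverse: z^2 is not 1 as 2m > 2, and z^m is
    a square root of 1 other than 1. *)
Lemma half_turn_root m : (2 <= m)%N ->
  exists z y : algC, [/\ z * y = 1, z != y & z ^+ m = - 1].
Proof.
move=> m2; have [|z zP] := @C_prim_root_exists (m + m); first by rewrite addn_gt0 (ltnW m2).
have z0 : z != 0.
  apply/eqP => z0; have /eqP := prim_expr_order zP.
  by rewrite z0 expr0n addn_eq0; case: m m2 {zP} => [|m] //= _; rewrite eq_sym oner_eq0.
exists z, z^-1; split; first by rewrite divff.
  apply/eqP => E; have : z ^+ 2 == 1 by rewrite expr2 {2}E divff.
  by rewrite -(prim_order_dvd zP) => /dvdn_leq; lia.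
have /eqP := prim_expr_order zP; rewrite exprD -expr2 sqrf_eq1 => /orP[|/eqP //].
by rewrite -(prim_order_dvd zP) => /dvdn_leq; lia.
Qed.

(** Equivalent words play alike. On the indicator function of [s], firing [s] puts -1 at [s], while
    firing another generator leaves 1 there. *)
Lemma coxeter_generator_inj (D : finType) (M : D -> D -> nat) (s t : D) :
  is_coxeter_matrix M -> coxeq M [:: s] [:: t] -> s = t.
Proof.
move=> [_ [Msym M1]].
(* The bound on [m] sits inside the existential, so every entry of [M] gets a weight, with no
   constraint for the diagonal and for the code 0 of infinity. As the weight depends on [M s t]
   only, it is symmetric. *)
have rootP m : exists z : algC, (2 <= m)%N ->
    exists y : algC, exists z', [/\ z = z' + y, z' * y = 1, z' != y & z' ^+ m = - 1].
  have [/half_turn_root[z [y H]]|lt] := leqP 2 m; last by exists 0.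
  by exists (z + y) => _; exists y, z; case: H.
pose c (s t : D) : algC := sval (constructive_indefinite_description _ (rootP (M s t))).
have csym x y : c x y = c y x by rewrite /c Msym.
have inv u v : coxeq M u v -> forall f, play c u f = play c v f.
  elim=> {u v} [u v|//|u v _ IH f|u v w _ IH1 _ IH2 f]; last 2 first.
  - by rewrite IH.
  - by rewrite IH1.
  case=> [p q x|p q x|p q x y xy Mxy] f; rewrite !play_cat //=.
  - by rewrite fireK.
  - by rewrite fireK.
  have M2 : (2 <= M x y)%N by have := M1 x y xy; case: (M x y) Mxy => [|[]].
  have [b [z [Ec zb nzb zm]]] :=
    svalP (constructive_indefinite_description _ (rootP (M x y))) M2.
  by rewrite (play_braid _ xy (csym x y) Ec zb nzb zm).
move=> /inv/(_ [ffun r => if r == s then 1 else 0]) E.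
apply/eqP; apply: contraT => st.
have := congr1 (fun f : {ffun D -> algC} => f s) E.
rewrite /= !ffunE eqxx (negPf st) [t == s]eq_sym (negPf st) mulr0 addr0 => /eqP.
by rewrite eq_sym -addr_eq0 -mulr2n pnatr_eq0.
Qed.

(** * The group as words modulo the Coxeter relations *)

Section Words.
Local Open Scope nat_scope.
Variables (D : finType) (M : D -> D -> nat).
Implicit Types (p q u v w x y : seq D) (s t : D) (Y : {set D}).
Local Notation "u =w v" := (coxeq M u v) (at level 70).

Lemma coxeq_refl u : u =w u. Proof. exact: rst_refl. Qed.
Lemma coxeq_sym u v : u =w v -> v =w u. Proof. exact: rst_sym. Qed.
Lemma coxeq_trans v u w : u =w v -> v =w w -> u =w w.
Proof. exact: rst_trans. Qed.
Hint Resolve coxeq_refl : core.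

Lemma cstep_ctx p q u v : cstep M u v -> cstep M (p ++ u ++ q) (p ++ v ++ q).
Proof.
case=> [p' q' s|p' q' s|p' q' s t st Mst].
- rewrite -!catA (catA p) [in X in cstep _ _ X]catA; exact: cs_del.
- rewrite -!catA (catA p) [in X in cstep _ _ X]catA; exact: cs_ins.
- rewrite -!catA (catA p) [in X in cstep _ _ X]catA; exact: cs_braid.
Qed.

Lemma coxeq_ctx p q u v : u =w v -> p ++ u ++ q =w p ++ v ++ q.
Proof.
elim=> [x y|x|x y _|x y z _ IH1 _ IH2].
- by move=> xy; apply: rst_step; apply: cstep_ctx.
- exact: coxeq_refl.
- exact: coxeq_sym.
- exact: coxeq_trans IH1 IH2.
Qed.

Lemma coxeq_cat u u' v v' : u =w u' -> v =w v' -> u ++ v =w u' ++ v'.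
Proof.
move=> uu' vv'; apply: (@coxeq_trans (u' ++ v)).
  exact: (coxeq_ctx [::] v).
by have := coxeq_ctx u' [::] vv'; rewrite !cats0.
Qed.

Lemma coxeq_catl p u v : u =w v -> p ++ u =w p ++ v.
Proof. exact: coxeq_cat. Qed.

Lemma coxeq_catr q u v : u =w v -> u ++ q =w v ++ q.
Proof. by move=> uv; apply: coxeq_cat. Qed.

Lemma coxeq_cons s u v : u =w v -> s :: u =w s :: v.
Proof. exact: (coxeq_catl [:: s]). Qed.

Lemma coxeq_ss s w : s :: s :: w =w w.
Proof. by apply: rst_step; apply: (cs_del M [::] w s). Qed.

Lemma coxeq_rcancel w : w ++ rev w =w [::].
Proof.
elim: w => [|s w IH] //.
rewrite rev_cons -cats1 /=.
apply: (coxeq_trans _ (coxeq_ss s [::])).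
by apply: coxeq_cons; rewrite catA; apply: (coxeq_catr [:: s] IH).
Qed.

Lemma coxeq_lcancel w : rev w ++ w =w [::].
Proof. by have := coxeq_rcancel (rev w); rewrite revK. Qed.

Lemma coxeq_VK w x : rev w ++ (w ++ x) =w x.
Proof. by rewrite catA; apply: (coxeq_catr x (coxeq_lcancel w)). Qed.

Lemma coxeq_KV w x : w ++ (rev w ++ x) =w x.
Proof. by rewrite catA; apply: (coxeq_catr x (coxeq_rcancel w)). Qed.

Lemma coxeq_moveL w x y : w ++ x =w y <-> x =w rev w ++ y.
Proof.
split=> H.
  by apply: coxeq_trans (coxeq_sym (coxeq_VK w x)) _; apply: coxeq_catl.
by apply: coxeq_trans (coxeq_catl w H) (coxeq_KV w y).
Qed.

Lemma coxeq_rev u v : u =w v -> rev u =w rev v.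
Proof.
move=> uv; have: v ++ rev u =w [::].
  by apply: coxeq_trans (coxeq_catr _ (coxeq_sym uv)) (coxeq_rcancel u).
by move/coxeq_moveL; rewrite cats0.
Qed.

Lemma coxeq_moveR w x y : x ++ w =w y <-> x =w y ++ rev w.
Proof.
split=> /coxeq_rev; rewrite rev_cat.
  by move/(iffLR (coxeq_moveL _ _ _))/coxeq_rev; rewrite rev_cat !revK.
by move/(iffRL (coxeq_moveL (rev w) _ _))/coxeq_rev; rewrite rev_cat !revK.
Qed.

(** * Parity of lengths and of reflection counts *)

Lemma coxeq_odd u v : u =w v -> odd (size u) = odd (size v).
Proof.
elim=> [x y|x|x y _|x y z _ -> _ ->] //.
case=> [p q s|p q s|p q s t _ _]; rewrite !size_cat ?size_alt // !oddD /=;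
  by case: (odd (size q)).
Qed.

(* The number of [i] such that the reflection [s_1 .. s_(i-1) s_i s_(i-1) .. s_1] read off
   [w = s_1 .. s_n] equals [x] in the group. *)
Definition refl_count : seq D -> seq D -> nat :=
  fix nr w x := if w is s :: w' then pbool ([:: s] =w x) + nr w' (s :: x ++ [:: s])
                else 0.

Lemma pbool_eq (P Q : Prop) : (P <-> Q) -> pbool P = pbool Q.
Proof. by move=> PQ; apply/pboolP/pboolP => /PQ. Qed.

Lemma coxeq_congr u v u' v' : u =w u' -> v =w v' -> (u =w v <-> u' =w v').
Proof.
move=> uu' vv'; split=> H.
  exact: coxeq_trans (coxeq_sym uu') (coxeq_trans H vv').
exact: coxeq_trans uu' (coxeq_trans H (coxeq_sym vv')).
Qed.

Lemma coxeq_conj s u v : u =w s :: v ++ [:: s] <-> s :: u ++ [:: s] =w v.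
Proof.
split=> H.
  exact: (iffRL (coxeq_moveL [:: s] _ _) (iffRL (coxeq_moveR [:: s] u (s :: v)) H)).
exact: (iffLR (coxeq_moveR [:: s] u (s :: v)) (iffLR (coxeq_moveL [:: s] _ _) H)).
Qed.

Lemma refl_countE w x y : x =w y -> refl_count w x = refl_count w y.
Proof.
elim: w x y => //= s w IH x y xy; congr (_ + _).
  by congr nat_of_bool; apply: pbool_eq; apply: coxeq_congr.
by apply: IH; apply: coxeq_cons; apply: coxeq_catr.
Qed.

Lemma refl_count_cat u v x :
  refl_count (u ++ v) x = refl_count u x + refl_count v (rev u ++ x ++ u).
Proof.
elim: u x => [|s u IH] x /=; first by rewrite cats0.
by rewrite IH addnA rev_cons -cats1 /= -!catA.
Qed.

(** The reflections read off an alternating word are the alternating words of odd length. *)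
Lemma refl_count_alt s t n x :
  refl_count (alt s t n) x = \sum_(i < n) pbool (alt s t i.*2.+1 =w x).
Proof.
elim: n s t x => [|n IH] s t x /=; first by rewrite big_ord0.
rewrite IH big_ord_recl /=; congr (_ + _); apply: eq_bigr => i _.
congr nat_of_bool; apply: pbool_eq.
apply: (iff_trans (coxeq_conj _ _ _)).
suff -> : s :: alt t s i.*2.+1 ++ [:: s] = alt s t (lift ord0 i).*2.+1 by [].
rewrite -[X in _ = alt _ _ X]/(i.+1.*2.+1) doubleS -[in RHS]addn1 [in RHS]alt_cat.
by rewrite /= odd_double.
Qed.

(** An alternating word of length 2m is trivial in the group, and the palindrome [alt t s b] is its
    own inverse. *)
Lemma alt_braid_refl s t m a b : alt s t m =w alt t s m -> a + b = m.*2 -> odd a ->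
  alt s t a =w alt t s b.
Proof.
move=> braid ab oa.
have ob: odd b by have := odd_double m; rewrite -ab oddD oa /=; case: (odd b).
have -> : alt t s b = rev (alt t s b) by rewrite rev_alt ob.
rewrite -[rev _]cat0s; apply/coxeq_moveR.
have -> : alt s t a ++ alt t s b = alt s t (a + b) by rewrite alt_cat oa.
rewrite ab -addnn alt_cat; apply: (coxeq_trans (coxeq_catr _ braid)).
suff -> : (if odd m then alt t s m else alt s t m) = rev (alt t s m).
  exact: coxeq_rcancel.
by rewrite rev_alt.
Qed.

(* The two sides of a braid relation have the same reflections, listed in opposite orders. *)
Lemma refl_count_braid s t m x : alt s t m =w alt t s m ->
  refl_count (alt s t m) x = refl_count (alt t s m) x.
Proof.
move=> braid; rewrite !refl_count_alt (reindex_inj rev_ord_inj) /=.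
apply: eq_bigr => i _; congr nat_of_bool; apply: pbool_eq; apply: coxeq_congr => //.
apply: (alt_braid_refl (a := (m - i.+1).*2.+1) (b := i.*2.+1) braid).
  by have := ltn_ord i; lia.
by rewrite /= odd_double.
Qed.

(** Deleting [s s] removes two equal reflections, and a braid move only reorders them; the letters
    that follow see an equal conjugate of [x]. *)
Lemma odd_refl_count u v x : u =w v -> odd (refl_count u x) = odd (refl_count v x).
Proof.
have del p q s y : odd (refl_count (p ++ [:: s; s] ++ q) y) = odd (refl_count (p ++ q) y).
  rewrite !refl_count_cat !oddD; congr (_ (+) _).
  set z := rev p ++ y ++ p => /=.
  have -> : pbool ([:: s] =w s :: z ++ [:: s]) = pbool ([:: s] =w z).
    apply: pbool_eq; apply: (iff_trans (coxeq_conj _ _ _)).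
    by apply: coxeq_congr => //; apply: coxeq_ss.
  rewrite addbF addbb /=; congr odd; apply: refl_countE.
  apply: (coxeq_trans (coxeq_ss _ _)).
  by have := coxeq_catl z (coxeq_ss s [::]); rewrite cats0.
elim=> {u v} [u v|//|//|u v w _ -> _ -> //].
case=> [p q s|p q s|p q s t st Mst]; rewrite ?del //.
have br: alt s t (M s t) =w alt t s (M s t).
  by have := rst_step _ _ _ _ (cs_braid [::] [::] st Mst); rewrite /= !cats0.
rewrite !refl_count_cat (refl_count_braid _ br); congr (odd (_ + (_ + _))).
apply: refl_countE; apply: coxeq_cat; first exact: coxeq_rev.
by apply: coxeq_catl.
Qed.

(** Multiplying [w] on the left by the reflection of its i-th letter deletes that letter. *)
Lemma refl_count_delete w x : refl_count w x != 0 ->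
  exists p r q, w = p ++ r :: q /\ x ++ w =w p ++ q.
Proof.
elim: w x => //= s w IH x.
case: pboolP => [sx _|_] /=.
  exists [::], s, w; split=> //=.
  by apply: coxeq_trans (coxeq_catr _ (coxeq_sym sx)) (coxeq_ss s w).
rewrite add0n => /IH[p [r [q [-> E]]]].
exists (s :: p), r, q; split=> //=.
apply: coxeq_trans (coxeq_cons s E).
by rewrite /= -catA /=; apply: coxeq_sym; apply: coxeq_ss.
Qed.

(** * Canonical reduced words, length and exchange *)

Lemma reduced_exists w : exists v, pbool (w =w v /\ reduced M v).
Proof.
have ex: exists n, pbool (exists2 v, w =w v & size v = n).
  by exists (size w); apply/pboolP; exists w.
case: (ex_minnP ex) => n /pboolP[v wv <-] min.
exists v; apply/pboolP; split=> // v' vv'; apply: min; apply/pboolP.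
by exists v' => //; apply: coxeq_trans wv vv'.
Qed.

(** [xchoose] depends only on the extension of the predicate, so all words of one element get the
    same reduced word. *)
Definition nf w : seq D := xchoose (reduced_exists w).
Definition len w := size (nf w).

Lemma nf_coxeq w : w =w nf w.
Proof. by have /pboolP[] := xchooseP (reduced_exists w). Qed.

Lemma nf_reduced w : reduced M (nf w).
Proof. by have /pboolP[] := xchooseP (reduced_exists w). Qed.

Lemma nf_eq u v : u =w v <-> nf u = nf v.
Proof.
split=> [uv|E].
  apply: eq_xchoose => z; apply: pbool_eq.
  split=> -[H rz]; split=> //.
    exact: coxeq_trans (coxeq_sym uv) H.
  exact: coxeq_trans uv H.
by apply: coxeq_trans (nf_coxeq u) _; rewrite E; apply/coxeq_sym/nf_coxeq.
Qed.

Lemma nfK w : nf (nf w) = nf w.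
Proof. by apply/nf_eq/coxeq_sym/nf_coxeq. Qed.

Lemma len_eq u v : u =w v -> len u = len v.
Proof. by move=> /nf_eq; rewrite /len => ->. Qed.

Lemma len_size w : len w <= size w.
Proof. by apply: nf_reduced; apply/coxeq_sym/nf_coxeq. Qed.

Lemma len_min u v : u =w v -> len u <= size v.
Proof. by move=> /len_eq->; apply: len_size. Qed.

Lemma reducedE w : reduced M w <-> len w = size w.
Proof.
split=> [rw|E v wv].
  by apply/eqP; rewrite eqn_leq len_size /= rw //; apply: nf_coxeq.
by rewrite -E; apply: len_min.
Qed.

Lemma odd_len w : odd (len w) = odd (size w).
Proof. by rewrite -(coxeq_odd (nf_coxeq w)). Qed.

Lemma len_cat u v : len (u ++ v) <= len u + len v.
Proof.
by rewrite -size_cat; apply: len_min; apply: coxeq_cat; apply: nf_coxeq.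
Qed.

Lemma len_rev w : len (rev w) = len w.
Proof.
have H u : len (rev u) <= len u.
  by rewrite [len u]/len -size_rev; apply: len_min; apply: coxeq_rev; apply: nf_coxeq.
by apply/eqP; rewrite eqn_leq H -{1}(revK w) H.
Qed.

Lemma len1 s : len [:: s] = 1.
Proof. by have := len_size [:: s]; have := odd_len [:: s]; case: len => [|[]]. Qed.

Lemma len0P w : len w = 0 <-> w =w [::].
Proof.
split=> [/size0nil E|/len_eq->]; first by rewrite -E; apply: nf_coxeq.
by apply/eqP; rewrite -leqn0; apply: (len_size [::]).
Qed.

(** The two lengths differ by at most 1, and parity excludes equality. *)
Lemma len_cons s w : len (s :: w) = (len w).+1 \/ len w = (len (s :: w)).+1.
Proof.
have up u : len (s :: u) <= (len u).+1 by have := len_cat [:: s] u; rewrite len1.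
have H1 := up w; have H2 := up (s :: w); rewrite (len_eq (coxeq_ss s w)) in H2.
have := odd_len (s :: w); rewrite /= -(odd_len w) => H3.
have: len (s :: w) != len w by apply/eqP => E; rewrite E in H3; case: odd H3.
by move/eqP; lia.
Qed.

(** Let [v] be a reduced word of s w, so w = s v. The reflection [s] occurs evenly often in [v], for
    otherwise a deletion would make s v shorter than [v]. Hence it occurs oddly often in s v, so
    also in [w], and the letter there can be deleted. *)
Lemma exchange s w : len (s :: w) < len w ->
  exists p r q, w = p ++ r :: q /\ s :: w =w p ++ q.
Proof.
move=> lt; apply: (@refl_count_delete w [:: s]).
set v := nf (s :: w); have svw : w =w s :: v.
  apply: coxeq_trans (coxeq_sym (coxeq_ss s w)) _.
  by apply: coxeq_cons; apply: nf_coxeq.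
suff ev : ~~ odd (refl_count v [:: s]).
  have: odd (refl_count w [:: s]).
    rewrite (odd_refl_count _ svw) /=.
    have -> : pbool ([:: s] =w [:: s]) by apply/pboolP.
    by rewrite add1n /= (refl_countE v (coxeq_ss s [:: s])).
  by case: (refl_count w).
apply/negP => od; have: refl_count v [:: s] != 0 by case: (refl_count v) od.
case/refl_count_delete => p [r [q [Ev E]]].
have := len_min E; rewrite -(len_eq svw).
have: len (s :: w) = size v by [].
by rewrite Ev !size_cat /=; lia.
Qed.

(** * Words over a subset and left descents *)

Definition over (Y : {set D}) (w : seq D) := all (mem Y) w.

Lemma over_rev Y w : over Y (rev w) = over Y w.
Proof. exact: all_rev. Qed.

Lemma over_cat Y u v : over Y (u ++ v) = over Y u && over Y v.
Proof. exact: all_cat. Qed.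

(** Exchange only deletes letters, so shortening a word over [Y] stays over [Y]. *)
Lemma over_reduced Y w : over Y w ->
  exists v, [/\ over Y v, w =w v & len w = size v].
Proof.
elim: w => [|s w IH] /=.
  by move=> _; exists [::]; split=> //; apply/len0P.
case/andP=> sY /IH[v [vY wv lw]].
have lsv := len_eq (coxeq_cons s wv).
have lv : len v = size v by rewrite -lw; apply/esym/len_eq.
case: (len_cons s v) => [up|down].
  exists (s :: v); split=> //=; [by rewrite sY|exact: coxeq_cons|].
  by rewrite lsv up lv.
have [|p [r [q [Ev E]]]] := @exchange s v; first by rewrite down.
exists (p ++ q); split.
- by move: vY; rewrite Ev !over_cat /= => /and3P[-> _ ->].
- exact: coxeq_trans (coxeq_cons s wv) E.
- by move: down; rewrite lsv lv Ev !size_cat /=; lia.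
Qed.

Definition ldesc (x : seq D) : {set D} := [set s | len (s :: x) < len x].

(** Induction on [u]: since [s] is a descent of x = u y, exchange deletes a letter of u y, and that
    letter must lie in [y]. *)
Lemma ldesc_prefix Y x u : Y \subset ldesc x -> over Y u -> len u = size u ->
  exists y, x =w u ++ y /\ len x = size u + size y.
Proof.
move=> /subsetP Yx; elim: u => [|s u IH] /=.
  by move=> _ _; exists (nf x); split=> //; apply: nf_coxeq.
case/andP=> sY uY lsu.
have lu : len u = size u.
  have := len_size u; have := len_cat [:: s] u; rewrite len1 lsu; lia.
have [y [xuy lx]] := IH uY lu.
have := Yx s sY; rewrite inE (len_eq xuy) (len_eq (coxeq_cons s xuy)).
case/exchange => p [r [q [E1 E2]]].
(* A deletion inside [u] would, after cancelling [y], shorten the reduced word [s :: u]. *)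
have [lt|ge] := ltnP (size p) (size u).
  have Eu: u = p ++ r :: drop (size p).+1 u.
    rewrite -{1}(cat_take_drop (size p) u) (drop_nth r) //.
    have -> : take (size p) u = p.
      by have := congr1 (take (size p)) E1;
      rewrite (take_size_cat _ (erefl (size p))) takel_cat // ltnW.
    congr (_ ++ _ :: _).
    by have := congr1 (nth r ^~ (size p)) E1; rewrite nth_cat lt nth_cat ltnn subnn.
  have Eq: q = drop (size p).+1 u ++ y.
    move: E1; rewrite {1}Eu -catA => /eqP; rewrite eqseq_cat // eqxx /=.
    by rewrite eqseq_cons eqxx => /eqP.
  move: E2; rewrite Eq catA => /(@coxeq_moveR y (s :: u)) E2.
  have: len (s :: u) <= size (p ++ drop (size p).+1 u).
    apply: len_min; apply: coxeq_trans E2 _; rewrite -catA.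
    by have := coxeq_catl (p ++ drop (size p).+1 u) (coxeq_rcancel y); rewrite cats0 -!catA.
  by rewrite lsu size_cat size_drop; lia.
(* The deletion falls in [y]: moving [s] to the front, x = s u y' with y' one letter shorter. *)
have Ep: p = u ++ drop (size u) p.
  rewrite -{1}(cat_take_drop (size u) p); congr (_ ++ _).
  by have := congr1 (take (size u)) E1; rewrite (take_size_cat _ (erefl (size u))) takel_cat.
have Ey: y = drop (size u) p ++ r :: q.
  by move: E1; rewrite {1}Ep -catA => /eqP; rewrite eqseq_cat // eqxx /= => /eqP.
exists (drop (size u) p ++ q); split.
  apply: coxeq_trans xuy _; apply: (coxeq_trans (coxeq_sym (coxeq_ss s _))).
  by apply: coxeq_cons; rewrite catA -Ep.
by rewrite -(len_eq xuy) lx Ey !size_cat /=; lia.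
Qed.

(** A reduced word of the inverse of [u] starts a reduced word of [x], and [u] cancels it. *)
Lemma len_ldesc Y x u : Y \subset ldesc x -> over Y u -> len (u ++ x) + len u = len x.
Proof.
move=> Yx uY; have [v [vY uv lv]] := @over_reduced Y (rev u) (etrans (over_rev Y u) uY).
have [|y [xy lx]] := ldesc_prefix Yx vY; first by rewrite -lv; apply/esym/len_eq.
have luv : u ++ v =w [::].
  by apply: coxeq_trans (coxeq_catl u (coxeq_sym uv)) (coxeq_rcancel u).
have E: u ++ x =w y.
  apply: coxeq_trans (coxeq_catl u xy) _; rewrite catA.
  exact: (coxeq_catr y luv).
have := len_cat v y; rewrite -(len_eq xy) (len_eq E) -(len_rev u) lv.
have := len_size y; have := len_size v; lia.
Qed.

(** * Enumeration of W by length and of its special subgroups *)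

Definition els k : seq (seq D) :=
  [seq w <- [seq val e | e <- enum {: k.-tuple D}] | nf w == w].

Lemma mem_els k w : (w \in els k) = (size w == k) && (nf w == w).
Proof.
rewrite mem_filter andbC; congr (_ && _).
apply/mapP/eqP => [[t _ ->]|<-]; first exact: size_tuple.
by exists (in_tuple w); rewrite ?mem_enum.
Qed.

Lemma uniq_els k : uniq (els k).
Proof. by rewrite filter_uniq // map_inj_uniq ?enum_uniq //; apply: val_inj. Qed.

Lemma uniq_nfP (ws : seq (seq D)) :
  (forall i j, i < size ws -> j < size ws -> i <> j ->
     ~ coxeq M (nth [::] ws i) (nth [::] ws j)) <-> uniq (map nf ws).
Proof.
split=> [H|/(uniqP [::]) U i j li lj ij /nf_eq E].
  apply/(uniqP [::]) => i j; rewrite !inE size_map => li lj.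
  rewrite !(nth_map [::]) // => /nf_eq E.
  by apply/eqP; apply: contraT => /eqP /(H i j li lj).
by apply: ij; apply: U; rewrite ?inE ?size_map // !(nth_map [::]).
Qed.

Lemma nf_id w : reduced M w -> size (nf w) = size w.
Proof. by move/reducedE. Qed.

Lemma num_of_length_els k n : num_of_length M k n -> n = size (els k).
Proof.
case=> ws [<- [red [dist all]]].
rewrite -(size_map nf); apply/perm_size/uniq_perm; rewrite ?uniq_els //.
  exact/uniq_nfP.
move=> w; rewrite mem_els; apply/mapP/andP => [[v /red[sv rv] ->]|[/eqP sw /eqP nw]].
  by rewrite nfK nf_id // sv !eqxx.
have [v vws wv] := all w sw (eq_ind _ (reduced M) (@nf_reduced w) _ nw).
by exists v => //; rewrite -[LHS]nw; apply/nf_eq.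
Qed.

Definition inW Y w := pbool (exists2 v, over Y v & w =w v).

Lemma inW_over Y w : over Y w -> inW Y w.
Proof. by move=> Yw; apply/pboolP; exists w. Qed.

Lemma inW_eq Y u v : u =w v -> inW Y u = inW Y v.
Proof.
move=> uv; apply: pbool_eq; split=> -[w Yw H]; exists w => //.
  exact: coxeq_trans (coxeq_sym uv) H.
exact: coxeq_trans uv H.
Qed.

Lemma inW_cat Y u v : inW Y u -> inW Y v -> inW Y (u ++ v).
Proof.
move=> /pboolP[u' Yu uu'] /pboolP[v' Yv vv']; apply/pboolP; exists (u' ++ v').
  by rewrite over_cat Yu.
exact: coxeq_cat.
Qed.

Lemma inW_rev Y u : inW Y u -> inW Y (rev u).
Proof.
move=> /pboolP[u' Yu uu']; apply/pboolP; exists (rev u'); first by rewrite over_rev.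
exact: coxeq_rev.
Qed.

Lemma len_ldescW Y x u : Y \subset ldesc x -> inW Y u -> len (u ++ x) + len u = len x.
Proof.
move=> Yx /pboolP[v Yv uv].
by rewrite (len_eq uv) (len_eq (coxeq_catr x uv)) (len_ldesc Yx Yv).
Qed.

Definition special_finite Y := exists E : seq (seq D), forall w, over Y w -> nf w \in E.

Lemma special_infiniteP Y : special_infinite M Y <-> ~ special_finite Y.
Proof.
split=> [inf [E EP]|nfin].
  have [ws [sw [Yw dist]]] := inf (size E).+1.
  have: uniq (map nf ws) by apply/uniq_nfP; rewrite sw.
  move/uniq_leq_size => /(_ E); rewrite size_map sw ltnn => H.
  suff: false by []; apply: H => _ /mapP[w wws ->].
  by apply: EP; apply/allP/Yw.
elim=> [|n [ws [sw [Yw dist]]]].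
  by exists [::]; split=> //; split=> // i j.
have [w [Yw' nw]] : exists w, over Y w /\ nf w \notin map nf ws.
  apply: NNPP => H; apply: nfin; exists (map nf ws) => w Yw'.
  by apply: contraT => nw; case: H; exists w.
exists (w :: ws); split; first by rewrite /= sw.
split=> [v|].
  by rewrite inE => /predU1P[->|/Yw //]; apply/allP.
have -> : n.+1 = size (w :: ws) by rewrite /= sw.
by apply/uniq_nfP; rewrite /= nw; apply/uniq_nfP; rewrite sw.
Qed.

(** Lengths in W_Y are bounded by that of [x], and each length has finitely many words. *)
Lemma ldesc_finite Y x : Y \subset ldesc x -> special_finite Y.
Proof.
move=> Yx; exists (flatten [seq els k | k <- iota 0 (len x).+1]) => w Yw.
apply/flatten_mapP; exists (len w); last by rewrite mem_els nfK !eqxx.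
by rewrite mem_iota add0n ltnS -(len_ldesc Yx Yw) leq_addl.
Qed.

(* Junk when [W_Y] is infinite: no list satisfies the specification. *)
Definition welts Y : seq (seq D) :=
  epsilon (inhabits [::])
    (fun E => uniq E /\ forall w, (w \in E) = (nf w == w) && inW Y w).

Lemma welts_spec Y : special_finite Y ->
  uniq (welts Y) /\ forall w, (w \in welts Y) = (nf w == w) && inW Y w.
Proof.
case=> E EP.
suff ex : exists E, uniq E /\ forall w, (w \in E) = (nf w == w) && inW Y w.
  exact: (epsilon_spec (inhabits [::]) _ ex).
exists (undup [seq w <- E | (nf w == w) && inW Y w]); split; first exact: undup_uniq.
move=> w; rewrite mem_undup mem_filter; case: eqP => //= nw.
rewrite /inW; case: pboolP => // -[v Yv /nf_eq E'].
by have := EP v Yv; rewrite -E' nw => ->.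
Qed.

(** * Elements with prescribed left descents, and cosets of W_Y *)

Definition desc_count Y k := count (fun x => Y \subset ldesc x) (els k).

Lemma ldesc_eq x y : x =w y -> ldesc x = ldesc y.
Proof.
by move=> xy; apply/setP => s; rewrite !inE (len_eq xy) (len_eq (coxeq_cons s xy)).
Qed.

Lemma canon_len w : nf w = w -> len w = size w.
Proof. by rewrite /len => ->. Qed.

Lemma desc_count_small Y u k : special_finite Y -> u \in welts Y -> k < size u ->
  desc_count Y k = 0.
Proof.
move=> /welts_spec[_ EY]; rewrite EY => /andP[/eqP nu Yu] ku.
apply/eqP; rewrite -leqn0 leqNgt -has_count; apply/hasPn => x.
rewrite mem_els => /andP[/eqP sx /eqP nx]; apply/negP => Yx.
by have := len_ldescW Yx Yu; rewrite (canon_len nu) (canon_len nx); lia.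
Qed.

(* Each coset [W_Y w] has exactly one element [x] all of whose left descents include [Y],
   namely its longest one, and [w] is recovered from [x] by an element of [W_Y]. *)
Lemma els_cosets Y k : special_finite Y ->
  size (els k) = \sum_(u <- welts Y) desc_count Y (k + size u).
Proof.
move=> /welts_spec[uE EY].
pose xs u := [seq x <- els (k + size u) | Y \subset ldesc x].
have xsE u x : (x \in xs u) = [&& Y \subset ldesc x, size x == k + size u & nf x == x].
  by rewrite mem_filter mem_els.
(* The sum counts pairs (u, x); the map to u x is then shown to be a bijection onto the elements of
   length [k]. *)
have -> : \sum_(u <- welts Y) desc_count Y (k + size u) =
    size [seq nf (ux.1 ++ ux.2) | ux <- [seq (u, x) | u <- welts Y, x <- xs u]].
  rewrite size_map size_allpairs_dep sumnE big_map.
  by apply: eq_bigr => u _; rewrite /xs size_filter.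
apply/perm_size/uniq_perm; first exact: uniq_els.
  rewrite map_inj_in_uniq.
    apply: allpairs_uniq_dep => //; first by move=> u _; rewrite filter_uniq ?uniq_els.
    by move=> [u x] [u' x'] _ _ [-> ->].
  move=> _ _ /allpairsPdep[u [x [uY xu ->]]] /allpairsPdep[v [y [vY yv ->]]] /= /nf_eq E.
  move: uY vY; rewrite !EY => /andP[/eqP nu Yu] /andP[/eqP nv Yv].
  move: xu yv; rewrite !xsE => /and3P[Yx _ /eqP nx] /and3P[Yy _ /eqP ny].
  have E1 : (rev v ++ u) ++ x =w y.
    by apply: coxeq_trans (coxeq_VK v y); rewrite -catA; apply: coxeq_catl.
  have E2 : rev (rev v ++ u) ++ y =w x.
    apply: coxeq_trans (coxeq_VK _ x).
    by apply: coxeq_catl; apply: coxeq_sym.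
  have Yg : inW Y (rev v ++ u) by apply: inW_cat => //; apply: inW_rev.
  (* The element rev v u takes [x] to [y] and its inverse takes [y] to [x], both lowering the length
     by the same amount, which must be 0. *)
  have := len_ldescW Yx Yg; have := len_ldescW Yy (inW_rev Yg).
  rewrite len_rev (len_eq E1) (len_eq E2) => l1 l2.
  have /len0P g1 : len (rev v ++ u) = 0 by lia.
  have uv : u =w v.
    by apply: coxeq_trans (coxeq_sym (coxeq_KV v u)) _;
      rewrite -[X in _ =w X]cats0; apply: coxeq_catl.
  have xy : x =w y.
    by apply: coxeq_trans E1; apply: coxeq_sym; apply: (coxeq_catr x g1).
  by rewrite -nu -nv -nx -ny (iffLR (nf_eq _ _) uv) (iffLR (nf_eq _ _) xy).
move=> w; apply/idP/mapP => [wk|[_ /allpairsPdep[u [x [uY xu ->]]] ->] /=]; last first.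
  move: uY xu; rewrite EY xsE mem_els nfK eqxx andbT.
  move=> /andP[/eqP nu Yu] /and3P[Yx /eqP sx /eqP nx].
  have := len_ldescW Yx Yu; rewrite (canon_len nu) (canon_len nx) sx /len => /addIn ->.
  exact: eqxx.
move: wk; rewrite mem_els => /andP[/eqP sw /eqP nw].
have e0 : nf [::] \in welts Y.
  by rewrite EY nfK eqxx -(inW_eq Y (nf_coxeq [::])) inW_over.
(* g w is a longest element of the coset W_Y w. *)
have [g gE gmax] : exists2 g, g \in welts Y &
    forall h, h \in welts Y -> len (h ++ w) <= len (g ++ w).
  have ex : exists n, has (fun h => len (h ++ w) == n) (welts Y).
    by exists (len (nf [::] ++ w)); apply/hasP; exists (nf [::]).
  case: (@ex_maxnP _ (\max_(h <- welts Y) len (h ++ w)) ex).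
    by move=> n /hasP[h hY /eqP <-];
      exact: (leq_bigmax_seq (P := xpredT) (F := fun h => len (h ++ w)) h hY isT).
  move=> n /hasP[g gY /eqP <-] max; exists g => // h hY.
  by apply: max; apply/hasP; exists h.
move: (gE); rewrite EY => /andP[/eqP ng Yg].
pose x := nf (g ++ w); pose u := nf (rev g).
have xg : x =w g ++ w by apply/coxeq_sym/nf_coxeq.
have ug : u =w rev g by apply/coxeq_sym/nf_coxeq.
have uxw : u ++ x =w w.
  by apply: coxeq_trans (coxeq_cat ug xg) (coxeq_VK g w).
have Yu : inW Y u by rewrite (inW_eq Y ug); apply: inW_rev.
have uY : u \in welts Y by rewrite EY nfK eqxx.
(* For [s] in [Y], the element s g w is in the same coset, so it cannot be longer than g w. *)
have Yx : Y \subset ldesc x.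
  apply/subsetP => s sY; rewrite (ldesc_eq xg) inE.
  have hY : nf (s :: g) \in welts Y.
    rewrite EY nfK eqxx -(inW_eq Y (nf_coxeq _)).
    by apply: (@inW_cat Y [:: s]) => //; apply: inW_over; rewrite /= sY.
  have := gmax _ hY; rewrite -(len_eq (coxeq_catr w (nf_coxeq (s :: g)))) /=.
  by case: (len_cons s (g ++ w)) => ->; rewrite ?ltnn.
exists (u, x) => /=; last by rewrite -(iffLR (nf_eq _ _) (coxeq_sym uxw)).
apply/allpairsPdep; exists u, x; split=> //.
rewrite xsE Yx nfK eqxx andbT /=.
have := len_ldescW Yx Yu.
by rewrite (len_eq uxw) !canon_len ?nfK // sw => ->.
Qed.

Lemma ldesc0P x : nf x = x -> (ldesc x == set0) = (x == [::]).
Proof.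
move=> nx; apply/eqP/eqP => [|->]; last first.
  apply/setP => s; rewrite !inE; apply/negP => /leq_trans/(_ (len_size _)).
  by rewrite ltn0.
case: x nx => // s x nx /setP/(_ s); rewrite !inE (len_eq (coxeq_ss s x)).
by rewrite (canon_len nx) /= ltnS len_size.
Qed.

Lemma els0 : els 0 = [:: [::]].
Proof.
apply: (perm_small_eq (s2 := [:: [::]])) => //; apply: uniq_perm; rewrite ?uniq_els //.
move=> w; rewrite mem_els inE size_eq0; case: eqP => //= ->.
by rewrite -size_eq0; apply/eqP/len0P.
Qed.

Lemma count_welts0 Y : special_finite Y -> count (fun u => size u == 0) (welts Y) = 1.
Proof.
move=> /welts_spec[U E]; rewrite -size_filter -[RHS]/(size [:: [::] : seq D]).
apply/perm_size/uniq_perm; rewrite ?filter_uniq // => u.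
rewrite mem_filter E inE size_eq0; case: eqP => //= ->; rewrite inW_over // andbT.
by rewrite -size_eq0; apply/eqP/len0P.
Qed.

(** Distinct generators stay distinct in W by the numbers game, and an element of W_Y of length 1 is
    a letter of [Y]. *)
Lemma count_welts1 Y : is_coxeter_matrix M -> special_finite Y ->
  count (fun u => size u == 1) (welts Y) = #|Y|.
Proof.
move=> coxM /welts_spec[U E]; rewrite -size_filter cardE -(size_map (fun s => [:: s])).
apply/perm_size/uniq_perm; rewrite ?filter_uniq ?map_inj_uniq ?enum_uniq //.
  by move=> s t [].
move=> u.
rewrite mem_filter E; apply/and3P/mapP => [[/eqP su /eqP nu /pboolP[v Yv uv]]|[s sY ->]].
  have [v' [Yv' vv' lv]] := over_reduced Yv.
  have sv' : size v' = 1 by rewrite -lv -(len_eq uv) (canon_len nu).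
  case: u v' su sv' uv vv' Yv' {nu lv} => [|s []] // [|r []] // _ _ uv vv' /= /andP[rY _].
  exists s; rewrite ?mem_enum // (coxeter_generator_inj coxM (coxeq_trans uv vv')) //.
move: sY; rewrite mem_enum => sY; split=> //; last by apply: inW_over; rewrite /= sY.
have := nf_coxeq [:: s]; have : size (nf [:: s]) = 1 := len1 s.
by case: (nf _) => [|r []] // _ /(coxeter_generator_inj coxM) ->.
Qed.

(** Excludes rank 1 for infinite W; there the alternating sum of |Y| would be -1 instead of 0. *)
Lemma rank1_finite (t : D) : (forall s, s = t) -> special_finite [set: D].
Proof.
move=> all; exists [:: nf [::]; nf [:: t]] => w _.
suff : w =w [::] \/ w =w [:: t].
  by rewrite !inE => -[/nf_eq->|/nf_eq->]; rewrite eqxx ?orbT.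
elim: w => [|s w [IH|IH]]; first by left.
  by right; rewrite (all s); apply: coxeq_cons.
by left; rewrite (all s); apply: coxeq_trans (coxeq_cons t IH) (coxeq_ss t [::]).
Qed.

End Words.

(** * Alternating sums over subsets *)

Section AlternatingSums.
Variable (D : finType).
Implicit Types (s : D) (Y : {set D}) (P : pred {set D}).

Definition toggle s Y := if s \in Y then Y :\ s else s |: Y.

Lemma toggleK s : involutive (toggle s).
Proof.
move=> Y; rewrite /toggle; case: (boolP (s \in Y)) => sY; first by rewrite setD11 setD1K.
by rewrite setU11 setU1K.
Qed.

Lemma in_toggle s Y t : t != s -> (t \in toggle s Y) = (t \in Y).
Proof. by rewrite /toggle => /negPf ts; case: ifP => _; rewrite !inE ts. Qed.

Lemma sign_toggle s Y : (-1) ^+ #|toggle s Y| = - (-1) ^+ #|Y| :> rat.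
Proof.
rewrite /toggle; case: ifP => sY; last by rewrite cardsU1 sY exprS mulN1r.
by rewrite [in RHS](cardsD1 s) sY exprS mulN1r opprK.
Qed.

(** [toggle s] is a sign-reversing involution on the sets satisfying [P]. *)
Lemma alternating_sum0 s P : (forall Y, P (toggle s Y) = P Y) ->
  \sum_(Y | P Y) (-1) ^+ #|Y| = 0 :> rat.
Proof.
move=> Ps; apply/eqP; rewrite -eqNr; apply/eqP.
rewrite [RHS](reindex_inj (inv_inj (toggleK s))) /= -sumrN.
by rewrite [RHS](eq_bigl _ _ Ps); apply: eq_bigr => Y _; rewrite sign_toggle.
Qed.

Lemma alternating_subsets (A : {set D}) :
  \sum_(Y : {set D} | Y \subset A) (-1) ^+ #|Y| = (A == set0)%:R :> rat.
Proof.
have [->|/set0Pn[s sA]] := eqVneq A set0.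
  by rewrite (eq_bigl _ _ (@subset0 D)) big_pred1_eq cards0.
apply: (alternating_sum0 (s := s)) => Y.
rewrite /toggle; case: ifP => sY; last by rewrite subUset sub1set sA.
apply/idP/idP => [H|]; last exact/subset_trans/subD1set.
by rewrite -(setD1K sY) subUset sub1set sA.
Qed.

(** Write |Y| as a sum over its members t and exchange the sums; toggling some other element
    preserves membership of t. *)
Lemma alternating_card_sum0 : (forall t : D, exists s, s != t) ->
  \sum_(Y : {set D}) (-1) ^+ #|Y| * #|Y|%:R = 0 :> rat.
Proof.
move=> big.
under eq_bigr => Y _ do rewrite -[X in _ * X%:R]sum1_card natr_sum mulr_sumr big_mkcond /=.
rewrite exchange_big big1 //= => t _; rewrite -big_mkcond /=.
under eq_bigr => Y _ do rewrite mulr1.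
have [s st] := big t; apply: (alternating_sum0 (s := s)) => Y.
by rewrite in_toggle // eq_sym.
Qed.

End AlternatingSums.

(** * The two leading coefficients of a polynomial *)

Section TopCoefficients.
Variable (F : comNzRingType).
Implicit Types (p q : {poly F}) (d e : nat).

(* [('X * p)`_d] is the coefficient below the top one, read as 0 when [d = 0]. *)
Definition top2 d p (x y : F) := [/\ (size p <= d.+1)%N, p`_d = x & ('X * p)`_d = y].

Lemma coefM_top d e p q : (size p <= d.+1)%N -> (size q <= e.+1)%N ->
  (p * q)`_(d + e) = p`_d * q`_e.
Proof.
move=> sp sq; have ld : (d < (d + e).+1)%N by rewrite ltnS leq_addr.
rewrite coefM (bigD1 (Ordinal ld)) //= addKn big1 ?addr0 // => i ni.
have [lt|ge] := ltnP i d.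
  by rewrite [q`_ _]nth_default ?mulr0 //; apply: (leq_trans sq); lia.
rewrite [p`_ _]nth_default ?mul0r //; apply: (leq_trans sp).
by rewrite ltn_neqAle ge andbT eq_sym.
Qed.

Lemma top2M d e p q x y x' y' : top2 d p x y -> top2 e q x' y' ->
  top2 (d + e) (p * q) (x * x') (x * y' + y * x').
Proof.
move=> [sp <- <-] [sq <- <-]; split; last 1 first.
(* Splitting off the leading term of [p], the rest times X still has degree at most [d]; this covers
   d = 0 uniformly. *)
- pose r := 'X * (p - p`_d *: 'X^d).
  have rd : r`_d = ('X * p)`_d.
    rewrite /r !coefXM; case: eqP => // /eqP d0; rewrite coefB coefZ coefXn.
    by rewrite (_ : d.-1 == d = false) ?mulr0 ?subr0 //; lia.
  have sr : (size r <= d.+1)%N.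
    apply/leq_sizeP => j dj; rewrite /r coefXM; case: eqP => // /eqP j0.
    rewrite coefB coefZ coefXn; have [->|nd] := eqVneq j.-1 d.
      by rewrite mulr1 subrr.
    by rewrite mulr0 subr0 nth_default //; apply: (leq_trans sp); lia.
  have -> : 'X * (p * q) = p`_d *: ('X^d * ('X * q)) + r * q.
    rewrite /r -!mul_polyC; ring.
  rewrite coefD coefZ coefXnM ltnNge leq_addr /= addKn.
  by rewrite coefM_top // rd.
- by have := size_polyMleq p q; lia.
- exact: coefM_top.
Qed.

Lemma top2_prod (I : Type) (r : seq I) (P : pred I) (d : I -> nat)
    (Q : I -> {poly F}) (y : I -> F) :
  (forall i, P i -> top2 (d i) (Q i) 1 (y i)) ->
  top2 (\sum_(i <- r | P i) d i) (\prod_(i <- r | P i) Q i) 1 (\sum_(i <- r | P i) y i).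
Proof.
move=> H; elim: r => [|i r IH].
  by rewrite !big_nil; split; rewrite ?size_poly1 ?coef1 ?mulr1 ?coefX.
rewrite !big_cons; case: ifP => // Pi.
by have := top2M (H i Pi) IH; rewrite !mul1r mulr1 addrC.
Qed.

Lemma top2_sum (I : finType) (P : pred I) d (c : I -> F) (Q : I -> {poly F}) (x y : I -> F) :
  (forall i, P i -> top2 d (Q i) (x i) (y i)) ->
  top2 d (\sum_(i | P i) c i *: Q i) (\sum_(i | P i) c i * x i) (\sum_(i | P i) c i * y i).
Proof.
move=> H; split.
- apply: (leq_trans (size_sum _ _ _)); apply/bigmax_leqP => i /H[s _ _].
  exact: leq_trans (size_scale_leq _ _) s.
- by rewrite coef_sum; apply: eq_bigr => i /H[_ <- _]; rewrite coefZ.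
- rewrite mulr_sumr coef_sum; apply: eq_bigr => i /H[_ _ <-].
  by rewrite -scalerAr coefZ.
Qed.

Lemma top2_Xn d : top2 d 'X^d 1 0.
Proof. by split; rewrite ?size_polyXn // -?exprS coefXn ?eqxx ?(ltn_eqF (ltnSn d)). Qed.

End TopCoefficients.

(** For n = 1 the second coefficient would be 0; with all n_i at least 2, the m factors of R
    contribute m. *)
Lemma top2_qint n : (2 <= n)%N -> top2 (n - 1) (qint n) 1 1.
Proof.
move=> n2; have qE k : (qint n)`_k = (k < n)%:R.
  rewrite coef_sum; under eq_bigr => i _ do rewrite coefXn.
  have [lt|ge] := ltnP k n.
    rewrite (bigD1 (Ordinal lt)) //= eqxx big1 ?addr0 // => i.
    by rewrite -val_eqE eq_sym => /negPf /= ->.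
  by rewrite big1 // => i _; rewrite gtn_eqF // (leq_trans (ltn_ord i)).
split; last 2 first.
- by rewrite qE; case: n n2 {qE} => // n _; rewrite subn1 ltnS leqnn.
- rewrite coefXM qE (_ : (n - 1 == 0)%N = false); last by lia.
  by rewrite (_ : ((n - 1).-1 < n)%N = true) //; lia.
- by apply/leq_sizeP => j jn; rewrite qE ltnNge (_ : (n <= j)%N = true) //; lia.
Qed.

(** * Congruence modulo powers of X *)

Section Truncation.
Variable (F : comNzRingType).
Implicit Types (p q r : {poly F}).

(** Identities of power series are stated for truncations at order [K]; identities of polynomials
    follow by varying [K]. *)
Definition eqX K p q := forall i, (i < K)%N -> p`_i = q`_i.

Lemma eqX_trans K q p r : eqX K p q -> eqX K q r -> eqX K p r.
Proof. by move=> pq qr i iK; rewrite pq ?qr. Qed.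

Lemma eqX_mulr K r p q : eqX K p q -> eqX K (p * r) (q * r).
Proof.
move=> pq i iK; rewrite !coefM; apply: eq_bigr => j _.
by rewrite pq // (leq_trans (ltn_ord j)).
Qed.

Lemma eqX_sum K (I : finType) (P : pred I) (c : I -> F) (p q : I -> {poly F}) :
  (forall i, P i -> eqX K (p i) (q i)) ->
  eqX K (\sum_(i | P i) c i *: p i) (\sum_(i | P i) c i *: q i).
Proof.
move=> pq i iK; rewrite !coef_sum; apply: eq_bigr => j Pj.
by rewrite !coefZ pq.
Qed.

Lemma eqX_all p q : (forall K, eqX K p q) -> p = q.
Proof. by move=> pq; apply/polyP => i; apply: (pq i.+1). Qed.

End Truncation.

(** * Descent series, the Poincaré series and their identity *)

Section PoincareSeries.
Variables (D : finType) (M : D -> D -> nat).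
Implicit Types (Y : {set D}).

Definition finb Y := ~~ pbool (special_infinite M Y).

Lemma finbP Y : reflect (special_finite M Y) (finb Y).
Proof.
apply: (iffP idP) => [/pboolP H|H].
  by apply: NNPP => /special_infiniteP.
by apply/pboolP => /special_infiniteP.
Qed.

Definition wlen Y := (\max_(u <- welts M Y) size u)%N.
(** Q_Y, the Poincaré polynomial of a finite W_Y with its coefficients reversed, so that the top
    ones count the elements of length 0 and 1. *)
Definition wpoly Y : {poly rat} := \sum_(u <- welts M Y) 'X^(wlen Y - size u).
(** A_Y truncated at order [K]. *)
Definition desc_series K Y : {poly rat} := \poly_(i < K) (desc_count M Y i)%:R.
Definition growth_series K : {poly rat} := \poly_(i < K) (size (els M i))%:R.

Lemma size_wlen Y u : u \in welts M Y -> (size u <= wlen Y)%N.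
Proof. by move=> uY; apply: (leq_bigmax_seq (P := xpredT) (F := size) u uY isT). Qed.

Lemma top2_wpoly Y : is_coxeter_matrix M -> finb Y ->
  top2 (wlen Y) (wpoly Y) 1 #|Y|%:R.
Proof.
move=> coxM /finbP fY; split.
- apply: (leq_trans (size_sum _ _ _)); apply/bigmax_leqP_seq => u _ _.
  by rewrite size_polyXn ltnS leq_subr.
- have -> : 1 = (count (fun u => size u == 0%N) (welts M Y))%:R :> rat.
    by rewrite count_welts0.
  rewrite coef_sum -sum1_count natr_sum [RHS]big_mkcond /= !big_seq.
  apply: eq_bigr => u /size_wlen lu; rewrite coefXn.
  have -> : (wlen Y == wlen Y - size u)%N = (size u == 0)%N by lia.
  by case: eqP.
- rewrite mulr_sumr coef_sum -(count_welts1 coxM fY) -sum1_count natr_sum.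
  rewrite [RHS]big_mkcond /= !big_seq.
  apply: eq_bigr => u /size_wlen lu; rewrite -exprS coefXn.
  have -> : (wlen Y == (wlen Y - size u).+1)%N = (size u == 1)%N by lia.
  by case: eqP.
Qed.

Lemma wpoly_desc K Y : finb Y ->
  eqX K (wpoly Y * desc_series K Y) ('X^(wlen Y) * growth_series K).
Proof.
move=> /finbP fY k kK; rewrite mulr_suml coef_sum coefXnM.
case: ltnP => [lt|ge].
  (* Below t^(L_Y) the index k - (L_Y - len u) is less than len u, too short for all of [Y] to be
     descents. *)
  rewrite big_seq big1 // => u uY; rewrite coefXnM; case: ltnP => // lu.
  rewrite coef_poly; case: ltnP => // _.
  by rewrite (desc_count_small fY uY) //; have := size_wlen uY; lia.
rewrite coef_poly (leq_ltn_trans (leq_subr _ _) kK) (els_cosets _ fY) natr_sum.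
rewrite !big_seq; apply: eq_bigr => u uY; have lu := size_wlen uY.
rewrite coefXnM ltnNge (leq_trans (leq_subr _ _) ge) /= coef_poly.
rewrite (leq_ltn_trans (leq_subr _ _) kK).
by congr (desc_count M Y _)%:R; rewrite subnBA // addnBAC.
Qed.

(** Exchanging sums, each x contributes the alternating sum over subsets of its descent set, which
    vanishes unless x is the identity. *)
Lemma desc_series_sum K : eqX K (\sum_(Y | finb Y) (-1) ^+ #|Y| *: desc_series K Y) 1.
Proof.
move=> k kK; rewrite coef_sum coef1.
transitivity (\sum_(x <- els M k) (ldesc M x == set0)%:R : rat).
  transitivity (\sum_(Y | finb Y) \sum_(x <- els M k)
      (if Y \subset ldesc M x then (-1) ^+ #|Y| else 0) : rat).
    apply: eq_bigr => Y _; rewrite coefZ coef_poly kK /desc_count -sum1_count.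
    rewrite natr_sum mulr_sumr big_mkcond; apply: eq_bigr => x _.
    by rewrite mulr1.
  rewrite exchange_big; apply: eq_bigr => x _ /=.
  (* Every subset of a descent set generates a finite subgroup, so the range is all subsets. *)
  rewrite -alternating_subsets -big_mkcondr; apply: eq_bigl => Y.
  by apply: andb_idl => Yx; apply/finbP/ldesc_finite/Yx.
rewrite big_seq (eq_bigr (fun x => (x == [::])%:R)); last first.
  by move=> x; rewrite mem_els => /andP[_ /eqP nx]; rewrite ldesc0P.
rewrite -big_seq; case: k {kK} => [|k]; first by rewrite els0 big_seq1.
rewrite big_seq big1 // => x; rewrite mem_els => /andP[/eqP sx _].
by case: x sx.
Qed.

(** Modulo X^K: multiply 1 = sum (-1)^|Y| A_Y by S and all Q_Z, replace Q_Y A_Y by t^(L_Y) W, then W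
    S by R. *)
Lemma poincare_identity (R S : {poly rat}) :
  (forall k : nat, \sum_(i < k.+1) (size (els M i))%:R * S`_(k - i) = R`_k) ->
  S * \prod_(Y | finb Y) wpoly Y =
  R * \sum_(Y | finb Y) (-1) ^+ #|Y| *:
        ('X^(wlen Y) * \prod_(Z | finb Z && (Z != Y)) wpoly Z).
Proof.
move=> WS; apply: eqX_all => K.
set PQ := \prod_(Y | finb Y) _; pose PY Y := \prod_(Z | finb Z && (Z != Y)) wpoly Z.
have WSK : eqX K (growth_series K * S) R.
  move=> k kK; rewrite -WS coefM; apply: eq_bigr => i _.
  by rewrite coef_poly (leq_trans (ltn_ord i)).
apply: (@eqX_trans _ _ ((\sum_(Y | finb Y) (-1) ^+ #|Y| *: desc_series K Y) * (S * PQ))).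
  rewrite -[X in eqX K X _]mul1r; apply: eqX_mulr => i iK.
  exact/esym/desc_series_sum.
rewrite mulr_suml mulr_sumr.
apply: (@eqX_trans _ _ (\sum_(Y | finb Y) (-1) ^+ #|Y| *:
    (growth_series K * S * ('X^(wlen Y) * PY Y)))).
  rewrite (eq_bigr (fun Y => (-1) ^+ #|Y| *: (wpoly Y * desc_series K Y * (S * PY Y)))).
    apply: eqX_sum => Y fY.
    have -> : growth_series K * S * ('X^(wlen Y) * PY Y) =
       'X^(wlen Y) * growth_series K * (S * PY Y) by ring.
    exact/eqX_mulr/wpoly_desc.
  move=> Y fY; rewrite -scalerAl /PQ (bigD1 Y) //= -/(PY Y); congr (_ *: _).
  by ring.
rewrite [X in eqX K _ X](eq_bigr (fun Y => (-1) ^+ #|Y| *: (R * ('X^(wlen Y) * PY Y)))).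
  by apply: eqX_sum => Y fY; apply: eqX_mulr.
by move=> Y fY; rewrite -scalerAr.
Qed.

(** With L the sum of the L_Y and y that of the |Y|, degree N + L gives b_N = sum (-1)^|Y|, and the
    next degree gives b_N y + b_(N-1) = sum (-1)^|Y| (y - |Y|) + m b_N, where y cancels. *)
Lemma top_coefficients (R S : {poly rat}) N (m : rat) :
  is_coxeter_matrix M ->
  (forall k : nat, \sum_(i < k.+1) (size (els M i))%:R * S`_(k - i) = R`_k) ->
  top2 N R 1 m ->
  ('X * S)`_N - m * S`_N = - \sum_(Y | finb Y) (-1) ^+ #|Y| * #|Y|%:R.
Proof.
move=> coxM WS RT; have := poincare_identity WS.
set PQ := \prod_(Y | finb Y) _; set B := \sum_(Y | finb Y) _ *: _.
pose L := (\sum_(Y | finb Y) wlen Y)%N; pose y : rat := \sum_(Y | finb Y) #|Y|%:R.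
have PT : top2 L PQ 1 y by apply: top2_prod => Y; apply: top2_wpoly.
have BT : top2 L B (\sum_(Y | finb Y) (-1) ^+ #|Y| * 1)
    (\sum_(Y | finb Y) (-1) ^+ #|Y| * (y - #|Y|%:R)).
  apply: top2_sum => Y fY; rewrite /L (bigD1 Y) //=.
  have -> : y - #|Y|%:R = \sum_(Z | finb Z && (Z != Y)) #|Z|%:R.
    by rewrite /y (bigD1 Y) //= addrAC subrr add0r.
  have PT' : top2 (\sum_(Z | finb Z && (Z != Y)) wlen Z)
      (\prod_(Z | finb Z && (Z != Y)) wpoly Z) 1 (\sum_(Z | finb Z && (Z != Y)) #|Z|%:R).
    by apply: top2_prod => Z /andP[fZ _]; apply: top2_wpoly.
  by have := top2M (top2_Xn _ (wlen Y)) PT'; rewrite !mul1r mul0r addr0.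
move=> E; have [sB EB0 EB1] := top2M RT BT.
(* The product of the Q_Y has degree exactly L, so the degree bound N + L on the right bounds that
   of [S] by N. *)
have sS : (size S <= N.+1)%N.
  have [->|S0] := eqVneq S 0; first by rewrite size_poly0.
  have [_ P1 _] := PT; have lP : (L < size PQ)%N.
    by rewrite ltnNge; apply/negP => /leq_sizeP/(_ L (leqnn L));
      rewrite P1 => /eqP; rewrite oner_eq0.
  have P0 : PQ != 0 by rewrite -size_poly_gt0 (leq_ltn_trans _ lP).
  move: sB; rewrite -E size_mul // => sB.
  rewrite -(leq_add2r L.+1); apply: (leq_trans (leq_add (leqnn _) lP)).
  by apply: (leq_trans (leqSpred _)); rewrite addSn addnS.
have ST : top2 N S S`_N ('X * S)`_N by [].
have [_ ES0 ES1] := top2M ST PT.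
rewrite E EB0 in ES0; rewrite E EB1 in ES1.
have sum1 : \sum_(Y | finb Y) (-1) ^+ #|Y| * 1 = S`_N by rewrite mul1r mulr1 in ES0.
rewrite sum1 mul1r mulr1 in ES1.
have dist : \sum_(Y | finb Y) (-1) ^+ #|Y| * (y - #|Y|%:R) =
    S`_N * y - \sum_(Y | finb Y) (-1) ^+ #|Y| * #|Y|%:R.
  rewrite -sum1 mulr_suml -sumrB; apply: eq_bigr => Y _.
  by rewrite mulrBr mulr1.
rewrite dist in ES1.
have -> : ('X * S)`_N = S`_N * y + ('X * S)`_N - S`_N * y by rewrite addrAC subrr add0r.
by rewrite -ES1; ring.
Qed.

End PoincareSeries.

(** * From finite to infinite special subgroups *)

Theorem mainTheorem10 (D : finType) (M : D -> D -> nat)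
  (a : nat -> nat) (ns : seq nat) (S : {poly rat}) :
  is_coxeter_matrix M ->
  (forall k, num_of_length M k (a k)) ->
  special_infinite M [set: D] ->
  (forall n, n \in ns -> (2 <= n)%N) ->
  (* W(t) * S(t) = R(t) as formal power series, R(t) = prod_i [n_i] *)
  (forall k : nat, \sum_(i < k.+1) (a i)%:R * S`_(k - i) = (\prod_(n <- ns) qint n)`_k) ->
  let m := size ns in
  let N := (\sum_(n <- ns) (n - 1))%N in
  (if N is N'.+1 then S`_N' else 0) - m%:R * S`_N =
    \sum_(X : {set D} | (X \proper [set: D]) && pbool (special_infinite M X))
        (-1) ^+ #|X| * #|X|%:R
    + (-1) ^+ #|[set: D]| * #|[set: D]|%:R.
Proof.
move=> coxM aP inf ns2 WS m N.
have RT : top2 N (\prod_(n <- ns) qint n) 1 m%:R.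
  have -> : m%:R = \sum_(n <- ns) 1%R :> rat by rewrite /m -sum1_size natr_sum.
  rewrite /N !big_seq; apply: top2_prod => n /ns2; exact: top2_qint.
have WS' k : \sum_(i < k.+1) (size (els M i))%:R * S`_(k - i) = (\prod_(n <- ns) qint n)`_k.
  by rewrite -WS; apply: eq_bigr => i _; rewrite (num_of_length_els (aP i)).
have := top_coefficients coxM WS' RT; rewrite coefXM.
have -> : (if N is N'.+1 then S`_N' else 0) = (if (N == 0)%N then 0 else S`_N.-1) by case: N RT.
move=> ->.
have tot : \sum_(Y : {set D}) (-1) ^+ #|Y| * #|Y|%:R = 0 :> rat.
  apply: alternating_card_sum0 => t; apply: NNPP => H.
  move/special_infiniteP: inf; apply; apply: (rank1_finite M (t := t)) => s.
  by apply/eqP; apply: contraT => st; case: H; exists s.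
(* The sum over all subsets being 0, minus its finite part is its infinite part, from which the term
   of D is split off. *)
move/eqP: tot; rewrite (bigID (finb M)) /= addr_eq0 => /eqP ->; rewrite opprK.
rewrite (bigD1 [set: D]) /=; last by rewrite negbK; apply/pboolP.
rewrite addrC; congr (_ + _); apply: eq_bigl => X.
by rewrite negbK properT andbC.
Qed.
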